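(* Let $\mathcal{F}$ be a class of maps satisfying the following for all Banach spaces $Y, Z, U, V$: (i) $\mathcal{F}(Y,Y)$ contains the identity map; (ii) $\mathcal{F}(Y,Z)$ is a vector space; (iii) if $A\colon Y\to U$ and $B\colon V\to Z$ are affine and $F\in\mathcal{F}(U,V)$, then $B\circ F\circ A\in\mathcal{F}(Y,Z)$. Let $\Phi$ be an affine equivariant numerical integrator. Then $\Phi$ preserves $\mathcal{F}$-invariants if and only if $\Phi$ is $\mathcal{F}$-functionally equivariant.
   Context: For a Banach space $Y$, $\mathfrak{X}(Y)$ denotes the vector fields on $Y$, viewed as maps $f\colon Y\to Y$. Regularity is left implicit: vector fields are taken regular enough that everything written makes sense. A numerical integrator is a collection of maps $\Phi=\{\Phi_f\colon Y\to Y \mid f\in\mathfrak{X}(Y),\ Y\text{ a Banach space}\}$, where $\Phi_f\colon y_0\mapsto y_1$ is one step with unit time step (time step $\Delta t$ corresponds to $\Phi_{\Delta t f}$). Affine equivariance: for an affine map $A\colon Y\to U$ with derivative (linear part) $A'$, vector fields $f\in\mathfrak{X}(Y)$ and $g\in\mathfrak{X}(U)$ are $A$-related if $A'\circ f=g\circ A$. $\Phi$ is affine equivariant if $A\circ\Phi_f=\Phi_g\circ A$ for all $A$-related $f,g$, all affine maps $A\colon Y\to U$, and all Banach spaces $Y,U$. A class of maps $\mathcal{F}$ assigns to each pair of Banach spaces $Y,Z$ a set $\mathcal{F}(Y,Z)$ of Gâteaux differentiable maps $Y\to Z$; $F'(y)v$ denotes the Gâteaux derivative of $F$ at $y$ in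 direction $v$. Preservation of $\mathcal{F}$-invariants: for all Banach spaces $Y,Z$, all $f\in\mathfrak{X}(Y)$ and all $F\in\mathcal{F}(Y,Z)$ that are invariants of $f$ (i.e. $F'(y)f(y)=0$ for all $y\in Y$), one has $F\circ\Phi_f=F$. $\mathcal{F}$-functional equivariance: for all Banach spaces $Y,Z$, all $F\in\mathcal{F}(Y,Z)$ and all $f\in\mathfrak{X}(Y)$, letting $g\in\mathfrak{X}(Y\times Z)$ be $g(y,z)=\bigl(f(y),F'(y)f(y)\bigr)$, one has $(\mathrm{id},F)\circ\Phi_f=\Phi_g\circ(\mathrm{id},F)$; that is, if $\Phi_f\colon y_0\mapsto y_1$, then $\Phi_g\colon(y_0,F(y_0))\mapsto(y_1,F(y_1))$. *)

(* Defs.v *)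
From HB Require Import structures.
From mathcomp Require Import all_boot all_order all_algebra.
From mathcomp Require Import boolp classical_sets functions reals.
From mathcomp Require Import topology normedtype derive.

Set Implicit Arguments.
Unset Strict Implicit.
Unset Printing Implicit Defensive.

Import Order.TTheory GRing.Theory Num.Theory.
Import numFieldNormedType.Exports.
Local Open Scope classical_set_scope.
Local Open Scope ring_scope.

(* MathComp-Analysis provides the product of two normed modules (with the
   sup norm) but not its completeness, needed to view it as a Banach space. *)
Section ProdComplete.
Variables (R : realType) (Y Z : completeNormedModType R).

HB.instance Definition _ := Pointed.on (Y * Z)%type.

Lemma prod_cauchy_cvg (F : set_system (Y * Z)%type) :
  ProperFilter F -> cauchy F -> cvg F.
Proof.
move=> FF cF.
have c1 : cauchy ((fst : Y * Z -> Y) @ F).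
  move=> E entE; rewrite near_simpl -near2E near_map2; apply: cF.
  exact: filterS (fun _ => @proj1 _ _) (prod_entP entE entourageT).
have c2 : cauchy ((snd : Y * Z -> Z) @ F).
  move=> E entE; rewrite near_simpl -near2E near_map2; apply: cF.
  exact: filterS (fun _ => @proj2 _ _) (prod_entP entourageT entE).
have f1 : cvg ((fst : Y * Z -> Y) @ F) by exact: cauchy_cvg.
have f2 : cvg ((snd : Y * Z -> Z) @ F) by exact: cauchy_cvg.
apply: (cvgP (lim ((fst : Y * Z -> Y) @ F), lim ((snd : Y * Z -> Z) @ F))).
move=> A /(cvg_pair f1 f2); rewrite /= nbhs_filterE /=.
by apply: filterS => -[].
Qed.

HB.instance Definition _ :=
  Uniform_isComplete.Build (Y * Z)%type prod_cauchy_cvg.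

End ProdComplete.

(* Affine maps between Banach spaces are continuous; the derivative A' of the
   affine map A is [linear_part A]. *)
Record affine_map (R : realType) (Y U : completeNormedModType R) := AffineMap {
  linear_part : {linear Y -> U};
  translation : U;
  linear_part_continuous : continuous linear_part
}.

Definition affine_fun (R : realType) (Y U : completeNormedModType R)
    (A : affine_map Y U) (y : Y) : U :=
  linear_part A y + translation A.

Coercion affine_fun : affine_map >-> Funclass.

(* A choice, for every Banach space Y, of the set of vector fields on Y.  It is
   a parameter because the regularity of the vector fields is not fixed (all
   maps, smooth maps, ...); see [regular_enough]. *)
Definition vector_fields (R : realType) :=
  forall Y : completeNormedModType R, set (Y -> Y).

Definition integrator (R : realType) (X : vector_fields R) :=
  forall Y : completeNormedModType R, X Y -> Y -> Y.

Definition are_related (R : realType) (Y U : completeNormedModType R)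
    (A : affine_map Y U) (f : Y -> Y) (g : U -> U) : Prop :=
  linear_part A \o f = g \o A.

Definition affine_equivariant (R : realType) (X : vector_fields R)
    (Phi : integrator X) : Prop :=
  forall (Y U : completeNormedModType R) (A : affine_map Y U)
         (f : X Y) (g : X U),
    are_related A (\val f) (\val g) -> A \o Phi Y f = Phi U g \o A.

(* Existence of all directional derivatives; linearity or continuity of
   G'(y) in the direction is not required. *)
Definition gateaux_differentiable (R : realType)
    (Y Z : completeNormedModType R) (G : Y -> Z) : Prop :=
  forall y v : Y, derivable G y v.

Record map_class (R : realType) := MapClass {
  class_maps :> forall Y Z : completeNormedModType R, set (Y -> Z);
  class_gateaux : forall (Y Z : completeNormedModType R) (G : Y -> Z),
    class_maps G -> gateaux_differentiable G
}.

Definition is_invariant_of (R : realType) (Y Z : completeNormedModType R)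
    (f : Y -> Y) (G : Y -> Z) : Prop :=
  forall y : Y, 'D_(f y) G y = 0.

(* The vector field (y, z) |-> (f(y), G'(y) f(y)) on Y * Z. *)
Definition augmented_field (R : realType) (Y Z : completeNormedModType R)
    (f : Y -> Y) (G : Y -> Z) : Y * Z -> Y * Z :=
  fun p => (f p.1, 'D_(f p.1) G p.1).

(* The standing assumption that the vector fields are regular enough for
   functional equivariance to make sense: the augmented field is again one of
   the vector fields.  It holds trivially when every map is a vector field. *)
Definition regular_enough (R : realType) (F : map_class R)
    (X : vector_fields R) : Prop :=
  forall (Y Z : completeNormedModType R) (f : Y -> Y) (G : Y -> Z),
    X Y f -> F Y Z G -> X (Y * Z)%type (augmented_field f G).

Definition preserves_invariants (R : realType) (F : map_class R)
    (X : vector_fields R) (Phi : integrator X) : Prop :=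
  forall (Y Z : completeNormedModType R) (f : X Y) (G : Y -> Z),
    F Y Z G -> is_invariant_of (\val f) G -> G \o Phi Y f = G.

(* By [regular_enough], g exists; it is unique as an element of the subtype. *)
Definition functionally_equivariant (R : realType) (F : map_class R)
    (X : vector_fields R) (Phi : integrator X) : Prop :=
  forall (Y Z : completeNormedModType R) (G : Y -> Z) (f : X Y)
         (g : X (Y * Z)%type),
    F Y Z G -> \val g = augmented_field (\val f) G ->
    (fun y => (y, G y)) \o Phi Y f = Phi (Y * Z)%type g \o (fun y => (y, G y)).

(* Main.v *)
Require Import Defs.
From HB Require Import structures.
From mathcomp Require Import all_boot all_order all_algebra.
From mathcomp Require Import boolp classical_sets functions reals.
From mathcomp Require Import topology normedtype derive.

Set Implicit Arguments.
Unset Strict Implicit.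
Unset Printing Implicit Defensive.

Import Order.TTheory GRing.Theory Num.Theory.
Import numFieldNormedType.Exports.
Local Open Scope classical_set_scope.
Local Open Scope ring_scope.

(** The graph of [G] is cut out of the product by the map [(y, z) |-> G y - z],
which is an invariant of the augmented field; preserving it keeps the numerical
solution on the graph, and the projection to the first factor identifies its
[Y]-component.  Conversely, if [G] is an invariant of [f] then the augmented
field is [(y, z) |-> (f y, 0)], which is related to [f] by every slice
[y |-> (y, c)], so its numerical solution keeps [z] constant. *)

Section ProductAffineMaps.
Variables (R : realType) (Y Z : completeNormedModType R).

Lemma id_continuous : continuous (idfun : {linear Y -> Y}).
Proof. by move=> y; exact: cvg_id. Qed.

(** Fills the trivial side when closure under [B \o G \o A] is needed with a single nontrivial
    affine factor. *)
Definition affine_id : affine_map Y Y := AffineMap 0 id_continuous.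

Lemma affine_idE : affine_fun affine_id = id.
Proof. by apply/funext => y; rewrite /affine_fun /= addr0. Qed.

Lemma fst_linear_continuous : continuous (fst : {linear (Y * Z)%type -> Y}).
Proof. by move=> p; exact: cvg_fst. Qed.

Definition affine_fst : affine_map (Y * Z)%type Y :=
  AffineMap 0 fst_linear_continuous.

Lemma affine_fstE : affine_fun affine_fst = fst.
Proof. by apply/funext => p; rewrite /affine_fun /= addr0. Qed.

Lemma snd_linear_continuous : continuous (snd : {linear (Y * Z)%type -> Z}).
Proof. by move=> p; exact: cvg_snd. Qed.

Definition affine_snd : affine_map (Y * Z)%type Z :=
  AffineMap 0 snd_linear_continuous.

Lemma affine_sndE : affine_fun affine_snd = snd.
Proof. by apply/funext => p; rewrite /affine_fun /= addr0. Qed.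

Definition inl_prod (y : Y) : (Y * Z)%type := (y, 0).

Lemma inl_prod_is_linear : linear inl_prod.
Proof.
by move=> a x y; apply/pair_equal_spec; split; rewrite //= scaler0 addr0.
Qed.

HB.instance Definition _ :=
  GRing.isLinear.Build R Y (Y * Z)%type *:%R inl_prod inl_prod_is_linear.

Lemma inl_prod_continuous : continuous (inl_prod : {linear Y -> (Y * Z)%type}).
Proof. by move=> y; apply: cvg_pair; [exact: cvg_id | exact: cvg_cst]. Qed.

(** The height [c] enters only through the translation, so every slice pushes [f] forward to a field
    with zero [Z]-component. *)
Definition affine_slice (c : Z) : affine_map Y (Y * Z)%type :=
  AffineMap (0, c) inl_prod_continuous.

Lemma affine_sliceE (c : Z) : affine_fun (affine_slice c) = fun y => (y, c).
Proof.
apply/funext => y; apply/pair_equal_spec.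
by split; rewrite /= ?addr0 ?add0r.
Qed.

Variables (f : Y -> Y) (G : Y -> Z).

Definition graph_defect (p : Y * Z) : Z := G p.1 - p.2.

(** Along the augmented field, [G \o fst] and [snd] both change at the rate ['D_(f p.1) G p.1], so
    the two contributions cancel. *)
Lemma graph_defect_invariant : gateaux_differentiable G ->
  is_invariant_of (augmented_field f G) graph_defect.
Proof.
move=> dG p; set v := augmented_field f G p.
(* The difference quotient of [G \o fst] at [p] along [v] is, by conversion, that of [G] at [p.1]
   along [v.1]. *)
have dfst : derivable (G \o fst) p v by exact: (dG p.1 v.1).
have dsnd : is_derive p v (snd : Y * Z -> Z) v.2.
  have lim_snd : (fun h : R => h^-1 *: ((h *: v + p).2 - p.2)) @ 0^' --> v.2.
    apply: cvg_near_cst; near=> h.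
    by rewrite /= addrK scalerA mulVf ?scale1r//; near: h; exact: nbhs_dnbhs_neq.
  by apply: DeriveDef; [exact: cvgP lim_snd | exact: cvg_lim lim_snd].
have -> : graph_defect = (G \o fst) - snd by [].
by rewrite deriveB// derive_val; exact: subrr.
Unshelve. all: by end_near. Qed.

End ProductAffineMaps.

Theorem theorem2p9 (R : realType) (F : map_class R) (X : vector_fields R)
    (F_id : forall Y : completeNormedModType R, F Y Y id)
    (F_vect : forall Y Z : completeNormedModType R,
       GRing.submod_closed [in F Y Z])
    (F_affine : forall (Y Z U V : completeNormedModType R)
       (A : affine_map Y U) (B : affine_map V Z) (G : U -> V),
       F U V G -> F Y Z (B \o G \o A))
    (X_regular : regular_enough F X)
    (Phi : integrator X)
    (Phi_affine : affine_equivariant Phi) :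
  preserves_invariants F Phi <-> functionally_equivariant F Phi.
Proof.
split=> [pres Y Z G f g FG gE | equi Y Z f G FG fG].
  apply/funext => y /=.
  have FGfst : F (Y * Z)%type Z (G \o fst).
    have := F_affine _ _ _ _ (affine_fst Y Z) (affine_id Z) _ FG.
    by rewrite affine_fstE affine_idE.
  have Fsnd : F (Y * Z)%type Z snd.
    have := F_affine _ _ _ _ (affine_id (Y * Z)%type) (affine_snd Y Z)
      _ (F_id _).
    by rewrite affine_sndE affine_idE.
  have FH : F (Y * Z)%type Z (graph_defect G).
    (* Submodule closure speaks of [a *: u + v], so the defect is obtained as
       [-1 *: snd + G \o fst]. *)
    have [_ /(_ (-1) snd (G \o fst))] := F_vect (Y * Z)%type Z.
    rewrite !inE => /(_ Fsnd FGfst); congr (class_maps F _).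
    by apply/funext => p; rewrite /graph_defect /= addrC; congr (_ + _);
      rewrite scaleN1r.
  have gH : is_invariant_of (\val g) (graph_defect G).
    by rewrite gE; apply: graph_defect_invariant; exact: class_gateaux FG.
  have onfst : (Phi (Y * Z)%type g (y, G y)).1 = Phi Y f y.
    have rel : are_related (affine_fst Y Z) (\val g) (\val f).
      by rewrite /are_related affine_fstE gE.
    have := Phi_affine _ _ _ _ _ rel.
    by rewrite affine_fstE => /(congr1 (@^~ (y, G y))).
  (* The defect vanishes at the initial point [(y, G y)], hence also after the step. *)
  have /(congr1 (@^~ (y, G y))) := pres _ _ _ _ FH gH.
  rewrite /graph_defect /= subrr onfst => /subr0_eq.
  by case: (Phi _ g (y, G y)) onfst => a b /= -> ->.
apply/funext => y /=.
have Xg := X_regular _ _ _ _ (set_valP f) FG.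
pose g : X (Y * Z)%type := SigSub (mem_set Xg).
have /(congr1 (@^~ y)) /= := equi Y Z G f g FG erefl.
(* The slice at height [G y] passes through the initial point of the graph. *)
have rel : are_related (affine_slice Y (G y)) (\val f) (\val g).
  rewrite /are_related affine_sliceE; apply/funext => x.
  by apply/pair_equal_spec; split; rewrite //= fG.
(* The step of [g] from [(y, G y)] now has two expressions, with second components [G (Phi Y f y)]
   and [G y]. *)
have := Phi_affine _ _ _ _ _ rel.
by rewrite affine_sliceE => /(congr1 (@^~ y)) /= <- [].
Qed.
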